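(* Let $n\geq m\geq 1$ be integers and let $d:=n+1-\left\lfloor \frac{n+1}{m+1}\right\rfloor-\left\lceil \frac{n+1}{m+1}\right\rceil$. Then: (1) For all $0\leq k\leq d$, $$\sum_{j=0}^k (-1)^{k-j}\binom{d-j}{k-j}\binom{n-j+1,\;m}{j}=\sum_{\ell=0}^{\left\lfloor \frac{k}{m}\right\rfloor}(-1)^{\ell}\sum_{j=m\ell}^k(-1)^{k-j}\binom{d-j}{k-j}\binom{n-j+1}{\ell}\binom{n-m\ell}{j-m\ell}.$$ (2) For all $0\leq k\leq d$, $$\sum_{j=0}^k (-1)^{k-j}\binom{d-j}{k-j}\binom{n-j+1,\;m}{j}\geq 0.$$ (3) For all $0\leq k\leq d+1$, $$\sum_{j=0}^k (-1)^{k-j}\binom{d+1-j}{k-j}\binom{n-j+1,\;m}{j}\leq \binom{n-d+k-2}{k}.$$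
   Context: For integers $N\geq 0$, $m\geq 1$ and $k\geq 0$, the symbol $\binom{N,\;m}{k}$ denotes the coefficient of $x^k$ in the expansion of $(1+x+\cdots+x^{m-1})^{N}$. The symbols $\binom{a}{b}$ without a second upper entry are ordinary binomial coefficients, with the usual convention $\binom{a}{0}=1$ for every integer $a$ (including $a=-1$). *)

(* Defs.v *)
From mathcomp Require Import all_boot all_order all_algebra.

Set Implicit Arguments.
Unset Strict Implicit.
Unset Printing Implicit Defensive.

Import GRing.Theory.
Local Open Scope ring_scope.

Definition polynomial_coef (N m k : nat) : int :=
  ((\sum_(i < m) 'X^i : {poly int}) ^+ N)`_k.

Definition ceil_divn (a b : nat) : nat := (a %/ b + ~~ (b %| a))%N.

(* For 1 <= m <= n, both quotients are at least 1 and their sum is at most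
   n + 1, so the subtractions are exact and d_of n m <= n - 1. *)
Definition d_of (n m : nat) : nat :=
  (n + 1 - (n + 1) %/ (m + 1) - ceil_divn (n + 1) (m + 1))%N.

(* The upper entry of an ordinary binomial coefficient is an integer that may
   equal -1, with binomial -1 over 0 equal to 1; this is the generalized
   coefficient a (a - 1) ... (a - k + 1) / k!, the division being exact. *)
Definition binz (a : int) (k : nat) : int :=
  ((\prod_(i < k) (a - i%:Z)) %/ (k`!)%:Z)%Z.

Lemma binz_nat (a k : nat) : binz a%:Z k = ('C(a, k))%:Z.
Proof.
rewrite /binz; have -> : \prod_(i < k) (a%:Z - i%:Z) = (a ^_ k)%:Z.
  elim: k => [|k IHk]; first by rewrite big_ord0 ffactn0.
  rewrite big_ord_recr /= IHk ffactnSr PoszM.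
  case: (leqP k a) => [le_ka | lt_ak]; first by rewrite subzn.
  by rewrite ffact_small // !mul0r.
by rewrite -bin_ffact PoszM mulzK // eqz_nat -lt0n fact_gt0.
Qed.

Lemma binz0 (a : int) : binz a 0 = 1.
Proof. by rewrite /binz big_ord0. Qed.

(* Main.v *)
(* Put N = n + 1, let c(a, j) be the coefficient of X^j in (1 + ... + X^(m-1))^a
   and W_N = \sum_j c(N - j, j) X^j (1 - X)^(N - j), which is (1 - X) times the
   K-polynomial of the complex of subsets of [1, n] without m consecutive
   elements. With D in place of d or d + 1, the alternating sum is the coefficient
   of X^k in W_N / (1 - X)^(N - D). Put e = floor(N/(m+1)) + ceil(N/(m+1)), so
   that d = N - e. The two inequalities follow from the fact that W_N / (1 - X)^e
   and ((1 - X) - W_N) / (1 - X)^(e-1) have nonnegative coefficients. Both are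
   proved by induction on N from the recursions
     W_(N+1) = \sum_(i < m, i <= N) X^i (1 - X) W_(N-i),
     W_(N+1) = W_N - X^m (1 - X) W_(N-m)  for N >= m.
   The identity is the expansion of (1 - X^m)^a / (1 - X)^a. *)
Require Import Defs.
From mathcomp Require Import all_boot all_order all_algebra.
From mathcomp Require Import ring zify.
Local Open Scope ring_scope.
Import GRing.Theory Num.Theory.

(** * Division by powers of 1 - X, truncated at degree M *)

Definition geo (M : nat) : {poly int} := \sum_(i < M) 'X^i.

Lemma mul_subX_geo (M : nat) : (1 - 'X) * geo M = 1 - 'X^M.
Proof. by rewrite -opprB mulNr -subrX1 opprB. Qed.

Lemma coef_geo (M k : nat) : (geo M)`_k = (k < M)%:R.
Proof.
rewrite /geo coef_sum; under eq_bigr do rewrite coefXn.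
case: (ltnP k M) => hk.
  rewrite (bigD1 (Ordinal hk)) //= eqxx big1 ?addr0 // => i.
  by rewrite -val_eqE /= eq_sym => /negPf ->.
rewrite big1 // => i _; have /ltn_eqF := leq_trans (ltn_ord i) hk.
by rewrite eq_sym => ->.
Qed.

Lemma coef_mul_geoK (M a k : nat) (f : {poly int}) : (k < M)%N ->
  (f * ((1 - 'X) * geo M) ^+ a)`_k = f`_k.
Proof.
move=> hk; rewrite mul_subX_geo; elim: a => [|a IHa] in f *.
  by rewrite expr0 mulr1.
by rewrite exprS mulrA IHa mulrBr mulr1 coefB coefMXn hk subr0.
Qed.

(** Cancelling one factor against 1 - X shows that consecutive coefficients of the power [s.+2]
    differ by a coefficient of the power [s.+1]; this is Pascal's rule. *)
Lemma coef_geoX (M s k : nat) : (k < M)%N ->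
  (geo M ^+ s.+1)`_k = ('C(s + k, k))%:Z.
Proof.
elim: s k => [|s IHs] k; move=> hk; first by rewrite expr1 coef_geo hk add0n binn.
elim: k hk => [|k IHk] hk.
  by rewrite exprS coef0M coef_geo hk mul1r IHs // !bin0.
have := coef_mul_geoK M 1 k.+1 (geo M ^+ s.+1) hk.
rewrite expr1 mulrCA -exprSr mulrBl mul1r coefB coefXM /= IHk ?(ltnW hk) //.
rewrite IHs // => /eqP; rewrite subr_eq => /eqP ->.
by rewrite -PoszD [(s.+1 + k.+1)%N]addSn binS addSnnS.
Qed.

(* In degrees below M, [geo M] is the inverse of [1 - 'X], so this says that the
   power series f / (1 - X)^e has nonnegative coefficients there. *)
Definition nneg_quot (M e : nat) (f : {poly int}) : Prop :=
  forall k : nat, (k < M)%N -> 0 <= (f * geo M ^+ e)`_k.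

Lemma nneg_quot_add M e f g :
  nneg_quot M e f -> nneg_quot M e g -> nneg_quot M e (f + g).
Proof. by move=> hf hg k hk; rewrite mulrDl coefD addr_ge0 ?hf ?hg. Qed.

Lemma nneg_quot_sum M e (I : Type) (r : seq I) (P : pred I) (F : I -> {poly int}) :
  (forall i, P i -> nneg_quot M e (F i)) ->
  nneg_quot M e (\sum_(i <- r | P i) F i).
Proof.
move=> hF; apply: big_ind => //; last exact: nneg_quot_add.
by move=> k _; rewrite mul0r coef0.
Qed.

Lemma nneg_quot_mull M e (h f : {poly int}) : (forall k, 0 <= h`_k) ->
  nneg_quot M e f -> nneg_quot M e (h * f).
Proof.
move=> hh hf k hk; rewrite -mulrA coefM sumr_ge0 // => i _.
by rewrite mulr_ge0 // hf // (leq_ltn_trans (leq_subr _ _)).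
Qed.

Lemma nneg_quot_Xn M e i f : nneg_quot M e f -> nneg_quot M e ('X^i * f).
Proof. by apply: nneg_quot_mull => k; rewrite coefXn; case: eqP. Qed.

Lemma nneg_quotS M e f : nneg_quot M e f -> nneg_quot M e.+1 f.
Proof.
have hg k : 0 <= (geo M)`_k by rewrite coef_geo; case: (k < M)%N.
by move=> /(nneg_quot_mull _ _ _ _ hg) hf k /hf; rewrite exprS mulrA [geo M * f]mulrC.
Qed.

Lemma nneg_quot_leq M e e' f : (e <= e')%N -> nneg_quot M e f -> nneg_quot M e' f.
Proof.
by move=> /subnK <- hf; elim: (e' - e)%N => // a; apply: nneg_quotS.
Qed.

Lemma nneg_quot_subX M e f : nneg_quot M e f -> nneg_quot M e.+1 ((1 - 'X) * f).
Proof.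
move=> hf k hk.
have -> : (1 - 'X) * f * geo M ^+ e.+1 = f * geo M ^+ e * ((1 - 'X) * geo M) ^+ 1.
  by rewrite exprS expr1; ring.
by rewrite coef_mul_geoK ?hf.
Qed.

(** * The polynomials W_N, here [run_poly m N], and their recursions *)

Definition run_poly (m N : nat) : {poly int} :=
  \sum_(j < N.+1) (polynomial_coef (N - j) m j)%:P * 'X^j * (1 - 'X) ^+ (N - j).

Lemma polynomial_coef0 m j : polynomial_coef 0 m j = (j == 0%N)%:R.
Proof. by rewrite /polynomial_coef expr0 coef1. Qed.

Lemma polynomial_coefS N m j :
  polynomial_coef N.+1 m j =
  \sum_(i < m | (i <= j)%N) polynomial_coef N m (j - i).
Proof.
rewrite /polynomial_coef exprS mulr_suml coef_sum [RHS]big_mkcond.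
by apply: eq_bigr => i _ /=; rewrite coefXnM; case: ltnP.
Qed.

Lemma run_poly0 m : run_poly m 0 = 1.
Proof. by rewrite /run_poly big_ord1 polynomial_coef0 !expr0 !mulr1. Qed.

(** Split off one factor 1 + ... + X^(m-1): choosing X^i from it turns (N, j) into (N - i, j - i),
    which keeps N - j unchanged. *)
Lemma run_poly_sum m N :
  run_poly m N.+1 = \sum_(i < m | (i <= N)%N) 'X^i * ((1 - 'X) * run_poly m (N - i)).
Proof.
rewrite /run_poly big_ord_recr /= subnn polynomial_coef0 /= !mul0r addr0.
have E (j : 'I_N.+1) :
    (polynomial_coef (N.+1 - j) m j)%:P * 'X^j * (1 - 'X) ^+ (N.+1 - j) =
    \sum_(i < m | (i <= j)%N)
      (polynomial_coef (N - j) m (j - i))%:P * 'X^j * (1 - 'X) ^+ (N - j).+1.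
  rewrite subSn -1?ltnS // polynomial_coefS rmorph_sum /= !mulr_suml.
  by [].
rewrite (eq_bigr _ (fun j _ => E j)).
rewrite (exchange_big_dep (fun i : 'I_m => (i <= N)%N)) /=; last first.
  by move=> j i _ /leq_trans; apply; rewrite -ltnS.
apply: eq_bigr => i hi.
pose G j :=
  (polynomial_coef (N - j) m (j - i))%:P * 'X^j * (1 - 'X : {poly int}) ^+ (N - j).+1.
rewrite -(big_mkord (fun j => i <= j)%N G) (big_cat_nat (n := i)) //=; last by rewrite leqW.
rewrite big_nat_cond big_pred0 ?add0r; last first.
  by move=> j /=; case: (ltnP j i); rewrite ?andbF.
rewrite -{1}[i : nat]add0n big_addn subSn // big_mkord mulrA mulr_sumr.
apply: eq_big => [j|j _]; first by rewrite leq_addl.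
rewrite /G addnK [(j + i)%N]addnC subnDA exprD exprS; ring.
Qed.

(** Telescoping: multiplying the sum for W_(N+1) by X shifts its index by one, so W_(N+2) - X
    W_(N+1) is the first summand [G 0] minus [G m]. *)
Lemma run_poly_rec m N :
  run_poly m N.+2 = run_poly m N.+1 -
    (if (m <= N.+1)%N then 'X^m * ((1 - 'X) * run_poly m (N.+1 - m)) else 0).
Proof.
pose G i : {poly int} :=
  if (i <= N.+1)%N then 'X^i * ((1 - 'X) * run_poly m (N.+1 - i)) else 0.
have E1 : run_poly m N.+2 = \sum_(i < m) G i by rewrite run_poly_sum big_mkcond.
have E2 : 'X * run_poly m N.+1 = \sum_(i < m) G i.+1.
  rewrite run_poly_sum big_mkcond mulr_sumr; apply: eq_bigr => i _.
  by rewrite /G ltnS subSS; case: leqP; rewrite ?mulr0 // mulrA -exprS.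
have : G 0%N + \sum_(i < m) G i.+1 = \sum_(i < m) G i + G m.
  by transitivity (\sum_(i < m.+1) G i); [rewrite big_ord_recl|rewrite big_ord_recr].
rewrite -E1 -E2 /G /= expr0 subn0 => /eqP; rewrite -subr_eq => /eqP <-.
ring.
Qed.

Lemma run_poly_small m r : (0 < r <= m)%N -> run_poly m r = 1 - 'X.
Proof.
case: r => // r; elim: r => [|r IHr] hr.
  rewrite run_poly_sum; case: m hr => // m _.
  by rewrite big_mkcond big_ord_recl big1 //= run_poly0 expr0 mul1r mulr1 addr0.
by rewrite run_poly_rec ifF ?subr0 ?IHr //; lia.
Qed.

(* When both terms occur, X^i - X^m is (1 - X) times a polynomial with nonnegative
   coefficients, so every summand stays nonnegative after division. *)
Lemma run_poly_addn m b r : (0 < r <= m)%N -> (m <= b)%N ->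
  run_poly m (b + r) = (1 - 'X) * run_poly m b +
    \sum_(1 <= i < m) ('X^i - (if (m < i + r)%N then 'X^m else 0)) *
                      ((1 - 'X) * run_poly m (b - i)).
Proof.
case: r => // r; elim: r => [|r IHr] hr hb.
  rewrite addn1 run_poly_sum; case: m hr hb => // m _ hb.
  rewrite big_mkcond big_ord_recl /= expr0 mul1r subn0; congr (_ + _).
  rewrite big_add1 big_mkord; apply: eq_bigr => i _.
  have := ltn_ord i => hi; rewrite /bump /= !add1n ifT; last by lia.
  by rewrite ifF ?subr0 //; lia.
have -> : (b + r.+2 = (b + r).+2)%N by lia.
rewrite run_poly_rec ifT; last by lia.
rewrite -addnS IHr //; last by lia.
rewrite -addrA; congr (_ + _).
(* Passing from [r.+1] to [r.+2] alters only the summand i = m - [r.+1], the one index where the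
   condition becomes true; its new -X^m is the term subtracted by [run_poly_rec]. *)
have hm : (1 <= m - r.+1 < m)%N by lia.
rewrite (big_cat_nat (n := (m - r.+1)%N)) /=; [|lia|lia].
rewrite [in RHS](big_cat_nat (n := (m - r.+1)%N)) /=; [|lia|lia].
rewrite -addrA; congr (_ + _).
  by apply: eq_big_nat => i hi; rewrite !ifF //; lia.
rewrite big_ltn; last by lia.
rewrite [in RHS]big_ltn; last by lia.
rewrite ifF; last by lia.
rewrite [in RHS]ifT; last by lia.
have -> : (b + r.+1 - m = b - (m - r.+1))%N by lia.
rewrite [in LHS](_ : \sum_(_ <= i < m) _ = \sum_((m - r.+1).+1 <= i < m)
   ('X^i - 'X^m) * ((1 - 'X) * run_poly m (b - i))); last first.
  by apply: eq_big_nat => i hi; rewrite ifT //; lia.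
rewrite [in RHS](_ : \sum_(_ <= i < m) _ = \sum_((m - r.+1).+1 <= i < m)
   ('X^i - 'X^m) * ((1 - 'X) * run_poly m (b - i))); last first.
  by apply: eq_big_nat => i hi; rewrite ifT //; lia.
ring.
Qed.

(** * Nonnegativity of W_N / (1 - X)^e and of its complement *)

Lemma subXn_geo (i m : nat) : (i <= m)%N ->
  'X^i - 'X^m = (1 - 'X) * ('X^i * geo (m - i)) :> {poly int}.
Proof.
move=> hi; rewrite mulrCA mul_subX_geo mulrBr mulr1 -exprD subnKC //.
Qed.

Lemma nneg_quot_run_poly M m q r : (0 < m)%N -> (r <= m)%N ->
  nneg_quot M (q.*2 + (0 < r))%N (run_poly m (q * m.+1 + r)).
Proof.
move=> hm; elim: q r => [|q IHq] r hr.
  rewrite mul0n add0n double0 add0n; case: r hr => [|r] hr.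
    by rewrite run_poly0 => k _; rewrite mulr1 coef1; case: (k == 0)%N.
  rewrite run_poly_small //= -[1 - 'X]mulr1; apply: nneg_quot_subX => k _.
  by rewrite mulr1 coef1; case: (k == 0)%N.
set b := (q.+1 * m.+1)%N; rewrite doubleS.
have hbm : (m <= b)%N by rewrite /b; lia.
(* Just below the multiple b of m + 1, the quotient is still q and the remainder is positive, so the
   order is 2q + 1. *)
have hbi i : (1 <= i <= m)%N -> nneg_quot M q.*2.+1 (run_poly m (b - i)).
  move=> hi; have := IHq (m.+1 - i)%N; have -> : (0 < m.+1 - i)%N by lia.
  have -> : (q * m.+1 + (m.+1 - i) = b - i)%N by rewrite /b; lia.
  by rewrite addn1; apply; lia.
have hb : nneg_quot M q.*2.+2 (run_poly m b).
  have eb : (b = b.-1.+1)%N by lia.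
  rewrite eb run_poly_sum; apply: nneg_quot_sum => i _; apply: nneg_quot_Xn.
  apply: nneg_quot_subX; have -> : (b.-1 - i = b - i.+1)%N by lia.
  by apply: hbi; have := ltn_ord i.
case: r hr => [|r] hr; first by rewrite !addn0.
rewrite addn1 run_poly_addn //; apply: nneg_quot_add; first exact: nneg_quot_subX.
rewrite big_nat_cond; apply: nneg_quot_sum => i; rewrite andbT => hi.
(* The target order is 2q + 3. With X^m present, both X^i - X^m and 1 - X raise the order 2q + 1 by
   one; otherwise only 1 - X does, and monotonicity in the order supplies the rest. *)
have {}hbi := hbi i; case: ifP => _.
  rewrite subXn_geo; last by lia.
  rewrite -mulrA; apply: nneg_quot_subX; rewrite -mulrA; apply: nneg_quot_Xn.
  apply: nneg_quot_mull => [k|]; first by rewrite coef_geo; case: (k < _)%N.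
  by apply: nneg_quot_subX; apply: hbi; lia.
rewrite subr0; apply: nneg_quot_Xn; apply: nneg_quotS; apply: nneg_quot_subX.
by apply: hbi; lia.
Qed.

Definition pole_order (m N : nat) : nat := (N %/ (m + 1) + ceil_divn N (m + 1))%N.

Lemma pole_orderE m q r : (r <= m)%N -> pole_order m (q * m.+1 + r) = (q.*2 + (0 < r))%N.
Proof.
move=> hr; rewrite /pole_order /ceil_divn addn1 divnMDl // dvdn_addr ?dvdn_mull //.
rewrite divn_small // addn0 addnA addnn; congr (_ + nat_of_bool _)%N.
case: r hr => // r hr; rewrite [LHS](_ : _ = true) //.
by apply/negP => /dvdn_leq; lia.
Qed.

Lemma nneg_quot_pole_order M m N : (0 < m)%N -> nneg_quot M (pole_order m N) (run_poly m N).
Proof.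
move=> hm; have hr : (N %% m.+1 <= m)%N by rewrite -ltnS ltn_mod.
by rewrite (divn_eq N m.+1) pole_orderE //; apply: nneg_quot_run_poly.
Qed.

Lemma pole_order_addn m N : pole_order m (N + m.+1) = (pole_order m N).+2.
Proof.
have hr : (N %% m.+1 <= m)%N by rewrite -ltnS ltn_mod.
rewrite {1 2}(divn_eq N m.+1) addnAC -mulSnr !pole_orderE //; lia.
Qed.

Lemma leq_pole_orderS m N : (pole_order m N <= pole_order m N.+1)%N.
Proof.
have hr : (N %% m.+1 <= m)%N by rewrite -ltnS ltn_mod.
rewrite {1 2}(divn_eq N m.+1) -addnS pole_orderE //.
move: hr; rewrite leq_eqVlt => /orP[/eqP ->|hr]; last by rewrite pole_orderE; lia.
by rewrite -mulSnr -[(_ * _)%N]addn0 pole_orderE; lia.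
Qed.

(** By the second recursion, the difference grows by X^m (1 - X) W_(N-m) at each step. Lowering the
    index by m + 1 lowers e by 2, and the factor 1 - X gives back one, whence e - 1. *)
Lemma nneg_quot_sub_run_poly M m N : (0 < m)%N -> (0 < N)%N ->
  nneg_quot M (pole_order m N).-1 (1 - 'X - run_poly m N).
Proof.
move=> hm; elim/ltn_ind: N => -[//|N] IHN _.
case: (leqP m N) => hN; last first.
  by rewrite run_poly_small // subrr => k _; rewrite mul0r coef0.
case: N => [|N] in IHN hN *; first by lia.
rewrite run_poly_rec hN opprB addrC -addrA [- _ + _]addrC.
apply: nneg_quot_add; last first.
  by apply: nneg_quot_leq (IHN N.+1 _ _) => //; have := leq_pole_orderS m N.+1; lia.
have -> : (N.+2 = (N.+1 - m) + m.+1)%N by lia.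
rewrite pole_order_addn /=; apply: nneg_quot_Xn; apply: nneg_quot_subX.
exact: nneg_quot_pole_order.
Qed.

(** * The alternating sums as coefficients of W_N / (1 - X)^(N - D) *)

Lemma coef_subX_exp (a k : nat) :
  ((1 - 'X : {poly int}) ^+ a)`_k = (-1) ^+ k * ('C(a, k))%:Z.
Proof.
elim: a k => [|a IHa] k.
  by rewrite expr0 coef1; case: k => [|k]; rewrite ?bin0n /= ?mulr0 ?mulr1.
rewrite exprS mulrBl mul1r coefB coefXM !IHa; case: k => [|k].
  by rewrite subr0 !bin0.
by rewrite binS PoszD exprS /=; ring.
Qed.

Lemma coef_run_poly_quot m N D k : (k <= D)%N -> (D < N)%N ->
  (run_poly m N * geo k.+1 ^+ (N - D))`_k =
  \sum_(0 <= j < k.+1)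
     (-1) ^+ (k - j) * ('C(D - j, k - j))%:Z * polynomial_coef (N - j) m j.
Proof.
move=> hkD hDN; rewrite /run_poly -(big_mkord xpredT
  (fun j => (polynomial_coef (N - j) m j)%:P * 'X^j * (1 - 'X) ^+ (N - j))).
rewrite (big_cat_nat (n := k.+1)) //=; last by lia.
rewrite mulrDl coefD !mulr_suml !coef_sum [X in _ + X = _](_ : _ = 0) ?addr0; last first.
  rewrite big_nat_cond big1 // => j; rewrite andbT => hj.
  by rewrite -!mulrA coefCM coefXnM ifT ?mulr0 //; lia.
apply: eq_big_nat => j hj.
(* The division leaves (1 - X)^(D - j), whose coefficient of X^(k-j) is the signed binomial. *)
have -> : (N - j = (D - j) + (N - D))%N by lia.
rewrite exprD -!mulrA -exprMn coefCM [RHS]mulrA [RHS]mulrC; congr (_ * _).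
rewrite coefXnM ifF; last by lia.
by rewrite coef_mul_geoK ?coef_subX_exp //; lia.
Qed.

(** * The binomial expansion of the alternating sums *)

Lemma sum_nat_tail0 (V : nmodType) (A B : nat) (F : nat -> V) : (A <= B)%N ->
  (forall l, (A <= l)%N -> F l = 0) ->
  \sum_(0 <= l < B) F l = \sum_(0 <= l < A) F l.
Proof.
move=> hAB hF; rewrite (big_cat_nat (n := A)) //= [X in _ + X = _](_ : _ = 0) ?addr0 //.
by rewrite big_nat_cond big1 // => l /andP[/andP[/hF]].
Qed.

Lemma polynomial_coef_expansion m a j : (0 < m)%N ->
  polynomial_coef a.+1 m j =
  \sum_(0 <= l < (j %/ m).+1)
    (-1) ^+ l * ('C(a.+1, l))%:Z * ('C(a + j - m * l, j - m * l))%:Z.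
Proof.
move=> hm; rewrite /polynomial_coef -/(geo m).
rewrite -(coef_mul_geoK j.+1 a.+1 j) // -exprMn mulrCA mulrA mul_subX_geo.
rewrite exprMn exprBn mulr_suml coef_sum -(big_mkord xpredT (fun l =>
  ((-1) ^+ l * 1 ^+ (a.+1 - l) * 'X^m ^+ l *+ 'C(a.+1, l) * geo j.+1 ^+ a.+1)`_j)).
have E l : ((-1) ^+ l * 1 ^+ (a.+1 - l) * 'X^m ^+ l *+ 'C(a.+1, l) * geo j.+1 ^+ a.+1)`_j =
  if (m * l <= j)%N then
    (-1) ^+ l * ('C(a.+1, l))%:Z * ('C(a + j - m * l, j - m * l))%:Z else 0.
  rewrite expr1n mulr1 -exprM mulrnAl -mulrA coefMn.
  have -> (p : {poly int}) : ((-1) ^+ l * p)`_j = (-1) ^+ l * p`_j.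
    by rewrite -signr_odd -[in RHS]signr_odd; case: (odd l);
      rewrite ?expr1 ?expr0 ?mulN1r ?mul1r ?coefN.
  rewrite coefXnM ltnNge; case: leqP => hl /=; last by rewrite mulr0 mul0rn.
  by rewrite coef_geoX ?addnBA //; [rewrite -mulr_natl natz; ring|lia].
(* Both ranges of l are extended to a common bound: the added terms vanish because l > a + 1 on one
   side and m l > j on the other. *)
rewrite (eq_bigr _ (fun l _ => E l)) -(sum_nat_tail0 _ _ (a.+2 + (j %/ m).+1)) ?leq_addr //.
  rewrite (sum_nat_tail0 _ (j %/ m).+1) ?leq_addl //.
    apply: eq_big_nat => l /andP[_]; rewrite ltnS leq_divRL // mulnC => hl.
    by rewrite hl.
  by move=> l; rewrite ltn_divLR // => hl; rewrite ifF // mulnC; apply/negbTE; rewrite -ltnNge.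
by move=> l hl; rewrite bin_small // mulr0 mul0r if_same.
Qed.

(** Taking a = n - j in the expansion makes a + j = n, so the last binomial has upper entry n - m l;
    then the two sums are exchanged. *)
Lemma sum_geo_expansion (n m d k : nat) : (0 < m)%N -> (k <= n)%N ->
  \sum_(0 <= j < k.+1)
     (-1) ^+ (k - j) * ('C(d - j, k - j))%:Z * polynomial_coef (n - j + 1) m j
  = \sum_(0 <= l < (k %/ m).+1) (-1) ^+ l *
      \sum_(m * l <= j < k.+1)
         (-1) ^+ (k - j) * ('C(d - j, k - j))%:Z * ('C(n - j + 1, l))%:Z
         * ('C(n - m * l, j - m * l))%:Z.
Proof.
move=> hm hkn.
pose G j l : int := (-1) ^+ (k - j) * ('C(d - j, k - j))%:Z *
  ((-1) ^+ l * ('C(n - j + 1, l))%:Z * ('C(n - m * l, j - m * l))%:Z).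
transitivity (\sum_(0 <= j < k.+1) \sum_(0 <= l < (k %/ m).+1 | (m * l <= j)%N) G j l).
  apply: eq_big_nat => j hj; rewrite addn1 polynomial_coef_expansion // mulr_sumr.
  rewrite [RHS]big_mkcond [RHS](sum_nat_tail0 _ (j %/ m).+1).
  - apply: eq_big_nat => l /andP[_]; rewrite ltnS leq_divRL // mulnC => hl.
    by rewrite hl /G addn1; congr (_ * (_ * _%:Z)); congr 'C(_, _); lia.
  - by rewrite ltnS leq_div2r; lia.
  - by move=> l; rewrite ltn_divLR // mulnC ltnNge => /negbTE ->.
rewrite (exchange_big_dep_nat xpredT) //=; apply: eq_big_nat => l hl.
rewrite mulr_sumr [RHS](big_nat_widenl _ 0) //=.
by apply: eq_bigr => j _; rewrite /G; ring.
Qed.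

(** For e = 0 the quotient is the constant 1; its coefficient at k = 0 is where the upper entry -1
    occurs. *)
Lemma coef_subX_geoX (e k : nat) : 
  ((1 - 'X) * geo k.+1 ^+ e.+1)`_k = binz (e%:Z + k%:Z - 1) k.
Proof.
have -> : (1 - 'X) * geo k.+1 ^+ e.+1 = geo k.+1 ^+ e * ((1 - 'X) * geo k.+1) ^+ 1.
  by rewrite expr1 exprS; ring.
rewrite coef_mul_geoK //; case: e => [|e].
  rewrite expr0 coef1; case: k => [|k]; first by rewrite binz0.
  have -> : (0%:Z + k.+1%:Z - 1 = k%:Z) by lia.
  by rewrite binz_nat bin_small.
have -> : (e.+1%:Z + k%:Z - 1 = (e + k)%:Z) by lia.
by rewrite binz_nat coef_geoX.
Qed.

Theorem theorem3p5 (n m : nat) (hm : (1 <= m)%N) (hmn : (m <= n)%N) :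
  let d := d_of n m in
  [/\ forall k : nat, (k <= d)%N ->
        \sum_(0 <= j < k.+1)
           (-1) ^+ (k - j) * ('C(d - j, k - j))%:Z * polynomial_coef (n - j + 1) m j
        = \sum_(0 <= l < (k %/ m).+1) (-1) ^+ l *
            \sum_(m * l <= j < k.+1)
               (-1) ^+ (k - j) * ('C(d - j, k - j))%:Z * ('C(n - j + 1, l))%:Z
               * ('C(n - m * l, j - m * l))%:Z,
      forall k : nat, (k <= d)%N ->
        0 <= \sum_(0 <= j < k.+1)
           (-1) ^+ (k - j) * ('C(d - j, k - j))%:Z * polynomial_coef (n - j + 1) m j
    & forall k : nat, (k <= d + 1)%N ->
        \sum_(0 <= j < k.+1)
           (-1) ^+ (k - j) * ('C(d + 1 - j, k - j))%:Z * polynomial_coef (n - j + 1) m j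
        <= binz (n%:Z - d%:Z + k%:Z - 2) k].
Proof.
move=> d; set e := pole_order m n.+1.
have hde : (d + e = n.+1)%N.
  have he : (e <= n.+1)%N.
    rewrite /e; have hr : (n.+1 %% m.+1 <= m)%N by rewrite -ltnS ltn_mod.
    have hq : (0 < n.+1 %/ m.+1)%N by rewrite divn_gt0.
    rewrite {1}(divn_eq n.+1 m.+1) pole_orderE //.
    have := divn_eq n.+1 m.+1; nia.
  by move: he; rewrite /d /d_of /e /pole_order !addn1; lia.
(* This makes d + 1 <= n, so the third sum also has a positive exponent N - D, and e - 2 is
   exact. *)
have he : (1 < e)%N.
  have hq : (0 < n.+1 %/ m.+1)%N by rewrite divn_gt0.
  rewrite /e (divn_eq n.+1 m.+1) pole_orderE; [lia|by rewrite -ltnS ltn_mod].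
have hsum D k : (k <= D)%N -> (D <= n)%N ->
    \sum_(0 <= j < k.+1)
      (-1) ^+ (k - j) * ('C(D - j, k - j))%:Z * polynomial_coef (n - j + 1) m j
    = (run_poly m n.+1 * geo k.+1 ^+ (n.+1 - D))`_k.
  move=> hkD hDn; rewrite coef_run_poly_quot //; apply: eq_big_nat => j hj.
  by congr (_ * polynomial_coef _ _ _); lia.
split=> k hk.
- by apply: sum_geo_expansion; lia.
- rewrite hsum //; last by lia.
  have -> : (n.+1 - d = e)%N by lia.
  exact: nneg_quot_pole_order.
rewrite hsum //; last by lia.
have -> : (n.+1 - (d + 1) = e.-2.+1)%N by lia.
(* Since n - d = e - 1, the bound is the coefficient of X^k in (1 - X) / (1 - X)^(e-1). *)
have -> : n%:Z - d%:Z + k%:Z - 2 = e.-2%:Z + k%:Z - 1 by lia.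
rewrite -coef_subX_geoX -subr_ge0 -coefB -mulrBl.
have -> : e.-2.+1 = e.-1 by lia.
exact: nneg_quot_sub_run_poly.
Qed.
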